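(* Let $\mathbf C,\mathbf D$ be categories, $\mathbf C$ with finite coproducts, and let $\#\colon\mathbf C\times(\mathbf C\times\mathbf D)\to\mathbf C$ be a parametrized monad with unit $\eta$ and Kleisli lifting $(-)^*$, such that all final coalgebras below exist. Then $X\#^\nu Z=\nu\gamma.\,X\#(\gamma,Z)$ defines a parametrized monad $\#^\nu\colon\mathbf C\times\mathbf D\to\mathbf C$ (with unit $\eta^\nu$ and Kleisli lifting $(-)^\ddagger$ described below). Moreover: (1) If $\#$ is guarded, then so is $\#^\nu$, with guardedness defined by: $f\colon X\to Y\#^\nu Z$ is $\sigma$-guarded iff $\mathrm{out}\circ f\colon X\to Y\#(Y\#^\nu Z,Z)$ is $\sigma$-guarded; and the assignment $\#\mapsto\#^\nu$ extends to a functor between the respective categories of guarded parametrized monads, sending a parametrized guarded monad morphism $\alpha\colon\#\to\#'$ to $\alpha^\nu$ with components $\mathrm{coit}(\alpha\circ\mathrm{out})$. (2) If $\#$ is guarded pre-iterative with iteration operator $(-)^\dagger$, then so is $\#^\nu$, with iteration operator sending $f\colon X\to_{\mathrm{inr}}(Y+X)\#^\nu Z$ to $f^{\dagger\dagger}=\mathrm{coit}\big([\eta,(\mathrm{out}\circ f)^\dagger]^*\circ\mathrm{out}\big)\circ\eta^\nu\circ\mathrm{inr}\colon X\to Y\#^\nu Z$, where $\mathrm{out}\colon(Y+X)\#^\nu Z\to(Y+X)\#((Y+X)\#^\nu Z,Z)$ and the coiteration is taken for the coalgebra $[\eta,(\mathrm{out}\circ f)^\dagger]^*\circ\mathrm{out}\colon(Y+X)\#^\nu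 Z\to Y\#((Y+X)\#^\nu Z,Z)$ of the functor $\gamma\mapsto Y\#(\gamma,Z)$. (3) If $\#$ is guarded iterative, then so is $\#^\nu$, with solutions as in (2).
   Context: A parametrized monad is a bifunctor $\#\colon\mathbf C\times\mathbf E\to\mathbf C$ such that for each $P\in\mathbf E$, $(-)\#P$ is a monad on $\mathbf C$ and for each $p\colon P\to P'$, $\mathrm{id}\#p$ is (the component of) a monad morphism $(-)\#P\to(-)\#P'$. Summands: $\sigma\colon Y'\triangleleft Y$ is a pair of morphisms exhibiting $Y$ as a coproduct, $\bar\sigma$ its complement. A monad $M$ (unit $\eta$, lifting $(-)^*$) is guarded if equipped with a relation $f\colon X\to_\sigma MY$ ($\sigma$ a summand of $Y$) closed under (trv) $M(\mathrm{inl})\circ f\colon X\to_{\mathrm{inr}}M(Y+Z)$ for all $f\colon X\to MY$; (par) $f\colon X\to_\sigma MZ$, $g\colon Y\to_\sigma MZ$ imply $[f,g]\colon X+Y\to_\sigma MZ$; (cmp) $f\colon X\to_{\mathrm{inr}}M(Y+Z)$, $g\colon Y\to_\sigma MV$, $h\colon Z\to MV$ imply $[g,h]^*\circ f\colon X\to_\sigma MV$. A guarded monad morphism preserves guardedness. A parametrized guarded monad has each $(-)\#P$ guarded and each $\mathrm{id}\#p$ a guarded monad morphism; it is guarded pre-iterative if each $(-)\#P$ is guarded pre-iterative (equipped with solutions $f^\dagger$, $f^\dagger=[\eta,f^\dagger]^*\circ f$, for all $f\colon X\to_{\mathrm{inr}}(Y+X)\#P$) and $(\mathrm{id}\#p)\circ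 g^\dagger=((\mathrm{id}\#p)\circ g)^\dagger$; guarded iterative if moreover solutions are unique. A parametrized (guarded) monad morphism is a natural transformation whose components $\alpha_{-,P}$ are (guarded) monad morphisms. Structure of $\#^\nu$ for fixed $Z$: write $\Gamma X=X\#^\nu Z$ with final coalgebra structure $\mathrm{out}\colon\Gamma X\to X\#(\Gamma X,Z)$ and coiteration $\mathrm{coit}$. The unit $\eta^\nu_X$ is the unique map with $\mathrm{out}\circ\eta^\nu_X=\eta_{X,(\Gamma X,Z)}$. For $f\colon X\to\Gamma Y$, $f^\ddagger\colon\Gamma X\to\Gamma Y$ is the unique map such that $[f^\ddagger,\mathrm{id}]$ is a coalgebra morphism from $(\Gamma X+\Gamma Y,[\hat f,(\mathrm{id}_Y\#(\mathrm{inr},\mathrm{id}_Z))\circ\mathrm{out}])$ to $(\Gamma Y,\mathrm{out})$ for the functor $\gamma\mapsto Y\#(\gamma,Z)$, where $\bar f=(\mathrm{id}_Y\#(\mathrm{inr},\mathrm{id}_Z))\circ\mathrm{out}\circ f$ and $\hat f=\bar f^*\circ(\mathrm{id}_X\#(\mathrm{inl},\mathrm{id}_Z))\circ\mathrm{out}$ (the lifting taken in the monad $(-)\#(\Gamma X+\Gamma Y,Z)$). The component of $\alpha^\nu$ at $(X,Z)$ is the unique coalgebra morphism $(X\#^\nu Z,\alpha\circ\mathrm{out})\to(X\#'^\nu Z,\mathrm{out}')$. *)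

(* Defs.v *)
From Stdlib Require Import FunctionalExtensionality ProofIrrelevance.

Set Implicit Arguments.
Unset Strict Implicit.
Unset Printing Implicit Defensive.

Declare Scope cat_scope.
Delimit Scope cat_scope with cat.
Open Scope cat_scope.

Record category := Category {
  ob :> Type;
  hom : ob -> ob -> Type;
  idm : forall X, hom X X;
  comp : forall X Y Z, hom Y Z -> hom X Y -> hom X Z;
  comp_idl : forall X Y (f : hom X Y), comp (idm Y) f = f;
  comp_idr : forall X Y (f : hom X Y), comp f (idm X) = f;
  comp_assoc : forall X Y Z W (h : hom Z W) (g : hom Y Z) (f : hom X Y),
    comp h (comp g f) = comp (comp h g) f
}.
Arguments idm {c} X.
Arguments comp {c X Y Z} g f.

Notation "X ~> Y" := (hom X Y) (at level 90, no associativity) : cat_scope.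
Notation "g ∘ f" := (comp g f) (at level 40, left associativity) : cat_scope.

Definition prod_cat (C D : category) : category.
Proof.
  refine (@Category (C * D)%type
            (fun A B => (hom (fst A) (fst B) * hom (snd A) (snd B))%type)
            (fun A => (idm (fst A), idm (snd A)))
            (fun A B E g f => (fst g ∘ fst f, snd g ∘ snd f)) _ _ _).
  - now intros A B [f g]; cbn; rewrite !comp_idl.
  - now intros A B [f g]; cbn; rewrite !comp_idr.
  - now intros A B E F h g f; cbn; rewrite !comp_assoc.
Defined.

Record functor_data (C D : category) := FunctorData {
  fob :> C -> D;
  fmap : forall X Y : C, (X ~> Y) -> (fob X ~> fob Y)
}.
Arguments fmap {C D} f {X Y} _.

Record is_functor (C D : category) (F : functor_data C D) : Prop := {
  fmap_id : forall X : C, fmap F (idm X) = idm (F X);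
  fmap_comp : forall (X Y Z : C) (g : Y ~> Z) (f : X ~> Y),
    fmap F (g ∘ f) = fmap F g ∘ fmap F f
}.

Class finite_coproducts (C : category) := FiniteCoproducts {
  initial : C;
  initial_mor : forall X : C, initial ~> X;
  initial_unique : forall (X : C) (f : initial ~> X), f = initial_mor X;
  coprod : C -> C -> C;
  cinl : forall X Y : C, X ~> coprod X Y;
  cinr : forall X Y : C, Y ~> coprod X Y;
  copair : forall X Y Z : C, (X ~> Z) -> (Y ~> Z) -> (coprod X Y ~> Z);
  copair_inl : forall (X Y Z : C) (f : X ~> Z) (g : Y ~> Z),
    copair f g ∘ cinl X Y = f;
  copair_inr : forall (X Y Z : C) (f : X ~> Z) (g : Y ~> Z),
    copair f g ∘ cinr X Y = g;
  copair_unique : forall (X Y Z : C) (f : X ~> Z) (g : Y ~> Z)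
      (h : coprod X Y ~> Z),
    h ∘ cinl X Y = f -> h ∘ cinr X Y = g -> h = copair f g
}.
Arguments cinl {C _ X Y}.
Arguments cinr {C _ X Y}.

Notation "X ⊕ Y" := (coprod X Y) (at level 50, left associativity) : cat_scope.
Notation "[ f ; g ]" := (copair f g) (at level 0, format "[ f ;  g ]") : cat_scope.

Definition is_coproduct (C : category) (A B Y : C) (i : A ~> Y) (j : B ~> Y) : Prop :=
  forall (Z : C) (f : A ~> Z) (g : B ~> Z),
    exists! h : Y ~> Z, h ∘ i = f /\ h ∘ j = g.

(* [sm_compl] is the complement of the summand [sm_inj]. *)
Record summand (C : category) (Y : C) := Summand {
  sm_ob : C;
  sm_cob : C;
  sm_inj : sm_ob ~> Y;
  sm_compl : sm_cob ~> Y;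
  sm_coproduct : is_coproduct sm_inj sm_compl
}.

Lemma cinr_is_coproduct (C : category) (K : finite_coproducts C) (Y Z : C) :
  is_coproduct (@cinr C K Y Z) (@cinl C K Y Z).
Proof.
  intros W f g; exists [g ; f]; split.
  - now split; [apply copair_inr | apply copair_inl].
  - now intros h [hr hl]; symmetry; apply copair_unique.
Qed.

Definition inr_summand (C : category) (K : finite_coproducts C) (Y Z : C) :
    summand (Y ⊕ Z) :=
  Summand (@cinr_is_coproduct C K Y Z).
Arguments inr_summand {C K Y Z}.

Record final_coalgebra (C : category) (F : functor_data C C) := FinalCoalgebra {
  nu : C;
  out : nu ~> F nu;
  coit : forall A : C, (A ~> F A) -> (A ~> nu);
  coit_mor : forall (A : C) (a : A ~> F A),
    out ∘ coit a = fmap F (coit a) ∘ a;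
  coit_unique : forall (A : C) (a : A ~> F A) (h : A ~> nu),
    out ∘ h = fmap F h ∘ a -> h = coit a
}.

Record monad_data (C : category) := MonadData {
  mob :> C -> C;
  ret : forall X : C, X ~> mob X;
  lift : forall X Y : C, (X ~> mob Y) -> (mob X ~> mob Y)
}.
Arguments ret {C} m X.
Arguments lift {C} m {X Y} _.

Record is_monad (C : category) (M : monad_data C) : Prop := {
  lift_ret : forall X : C, lift M (ret M X) = idm (M X);
  lift_comp_ret : forall (X Y : C) (f : X ~> M Y), lift M f ∘ ret M X = f;
  lift_comp : forall (X Y Z : C) (g : Y ~> M Z) (f : X ~> M Y),
    lift M (lift M g ∘ f) = lift M g ∘ lift M f
}.

Definition mmap (C : category) (M : monad_data C) (X Y : C) (f : X ~> Y) :
    M X ~> M Y :=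
  lift M (ret M Y ∘ f).

(* Naturality with respect to [mmap] follows from the two equations. *)
Record is_monad_morphism (C : category) (M N : monad_data C)
    (a : forall X : C, M X ~> N X) : Prop := {
  monad_morphism_ret : forall X : C, a X ∘ ret M X = ret N X;
  monad_morphism_lift : forall (X Y : C) (f : X ~> M Y),
    a Y ∘ lift M f = lift N (a Y ∘ f) ∘ a X
}.

Definition guardedness (C : category) (M : monad_data C) :=
  forall X Y : C, (X ~> M Y) -> summand Y -> Prop.

Record is_guarded (C : category) (K : finite_coproducts C) (M : monad_data C)
    (G : guardedness M) : Prop := {
  guarded_trv : forall (X Y Z : C) (f : X ~> M Y),
    G X (Y ⊕ Z) (mmap M cinl ∘ f) inr_summand;
  guarded_par : forall (X Y Z : C) (s : summand Z) (f : X ~> M Z) (g : Y ~> M Z),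
    G X Z f s -> G Y Z g s -> G (X ⊕ Y) Z [f ; g] s;
  guarded_cmp : forall (X Y Z V : C) (s : summand V)
      (f : X ~> M (Y ⊕ Z)) (g : Y ~> M V) (h : Z ~> M V),
    G X (Y ⊕ Z) f inr_summand -> G Y V g s -> G X V (lift M [g ; h] ∘ f) s
}.

Definition preserves_guardedness (C : category) (M N : monad_data C)
    (G : guardedness M) (H : guardedness N) (a : forall X : C, M X ~> N X) : Prop :=
  forall (X Y : C) (f : X ~> M Y) (s : summand Y), G X Y f s -> H X Y (a Y ∘ f) s.

Record pmonad_data (C E : category) := PMonadData {
  pm_functor :> functor_data (prod_cat C E) C;
  pm_ret : forall (X : C) (P : E), X ~> pm_functor (X, P);
  pm_lift : forall (X Y : C) (P : E),
    (X ~> pm_functor (Y, P)) -> (pm_functor (X, P) ~> pm_functor (Y, P))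
}.
Arguments pm_ret {C E} p X P.
Arguments pm_lift {C E} p {X Y P} _.

Definition pm_map (C E : category) (M : pmonad_data C E) (X Y : C) (P Q : E)
    (f : X ~> Y) (p : P ~> Q) : M (X, P) ~> M (Y, Q) :=
  @fmap _ _ M (X, P) (Y, Q) (f, p).
Arguments pm_map {C E} M {X Y P Q} f p.

Definition pm_at (C E : category) (M : pmonad_data C E) (P : E) : monad_data C :=
  @MonadData C (fun X => M (X, P)) (fun X => pm_ret M X P) (fun X Y => @pm_lift C E M X Y P).

Record is_pmonad (C E : category) (M : pmonad_data C E) : Prop := {
  pm_is_functor : is_functor M;
  pm_is_monad : forall P : E, is_monad (pm_at M P);
  pm_map_mmap : forall (P : E) (X Y : C) (f : X ~> Y),
    pm_map M f (idm P) = mmap (pm_at M P) f;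
  pm_is_monad_morphism : forall (P Q : E) (p : P ~> Q),
    @is_monad_morphism C (pm_at M P) (pm_at M Q) (fun X => pm_map M (idm X) p)
}.

Definition pm_guardedness (C E : category) (M : pmonad_data C E) :=
  forall P : E, guardedness (pm_at M P).

Record is_guarded_pmonad (C E : category) (K : finite_coproducts C)
    (M : pmonad_data C E) (G : pm_guardedness M) : Prop := {
  gpm_is_pmonad : is_pmonad M;
  gpm_is_guarded : forall P : E, is_guarded K (G P);
  gpm_preserves : forall (P Q : E) (p : P ~> Q),
    preserves_guardedness (G P) (G Q) (fun X => pm_map M (idm X) p)
}.

(* Solutions are only provided for guarded morphisms, hence the proof argument. *)
Definition pm_iteration (C E : category) (K : finite_coproducts C)
    (M : pmonad_data C E) (G : pm_guardedness M) :=
  forall (P : E) (X Y : C) (f : X ~> M (Y ⊕ X, P)),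
    G P X (Y ⊕ X) f inr_summand -> (X ~> M (Y, P)).

Definition is_solution (C E : category) (K : finite_coproducts C)
    (M : pmonad_data C E) (P : E) (X Y : C)
    (f : X ~> M (Y ⊕ X, P)) (g : X ~> M (Y, P)) : Prop :=
  g = pm_lift M [pm_ret M Y P ; g] ∘ f.

Record is_guarded_preiterative (C E : category) (K : finite_coproducts C)
    (M : pmonad_data C E) (G : pm_guardedness M) (dag : pm_iteration K G) : Prop := {
  gpi_is_guarded : is_guarded_pmonad K G;
  gpi_solution : forall (P : E) (X Y : C) (f : X ~> M (Y ⊕ X, P))
      (Hf : G P X (Y ⊕ X) f inr_summand),
    is_solution f (dag P X Y f Hf);
  gpi_compat : forall (P Q : E) (p : P ~> Q) (X Y : C) (g : X ~> M (Y ⊕ X, P))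
      (Hg : G P X (Y ⊕ X) g inr_summand)
      (Hpg : G Q X (Y ⊕ X) (pm_map M (idm (Y ⊕ X)) p ∘ g) inr_summand),
    pm_map M (idm Y) p ∘ dag P X Y g Hg
      = dag Q X Y (pm_map M (idm (Y ⊕ X)) p ∘ g) Hpg
}.

Record is_guarded_iterative (C E : category) (K : finite_coproducts C)
    (M : pmonad_data C E) (G : pm_guardedness M) (dag : pm_iteration K G) : Prop := {
  gi_is_preiterative : is_guarded_preiterative dag;
  gi_unique : forall (P : E) (X Y : C) (f : X ~> M (Y ⊕ X, P))
      (Hf : G P X (Y ⊕ X) f inr_summand) (g : X ~> M (Y, P)),
    is_solution f g -> g = dag P X Y f Hf
}.

Record gpmonad (C E : category) (K : finite_coproducts C) := GPMonad {
  gpm_data :> pmonad_data C E;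
  gpm_guard : pm_guardedness gpm_data;
  gpm_laws : is_guarded_pmonad K gpm_guard
}.
Arguments GPMonad {C E K gpm_data gpm_guard} gpm_laws.
Arguments gpm_guard {C E K} g P X Y _ _.

Definition pm_components (C E : category) (M N : pmonad_data C E) :=
  forall (X : C) (P : E), M (X, P) ~> N (X, P).

Record is_pmonad_morphism (C E : category) (M N : pmonad_data C E)
    (a : pm_components M N) : Prop := {
  pmm_natural : forall (X Y : C) (P Q : E) (f : X ~> Y) (p : P ~> Q),
    a Y Q ∘ pm_map M f p = pm_map N f p ∘ a X P;
  pmm_monad_morphism : forall P : E,
    @is_monad_morphism C (pm_at M P) (pm_at N P) (fun X => a X P)
}.

Record is_guarded_pmonad_morphism (C E : category) (M N : pmonad_data C E)
    (G : pm_guardedness M) (H : pm_guardedness N) (a : pm_components M N) : Prop := {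
  gpmm_is_pmonad_morphism : is_pmonad_morphism a;
  gpmm_preserves : forall P : E,
    preserves_guardedness (G P) (H P) (fun X => a X P)
}.

Definition gpmonad_hom (C E : category) (K : finite_coproducts C) (M N : gpmonad E K) :=
  { a : pm_components M N | is_guarded_pmonad_morphism (gpm_guard M) (gpm_guard N) a }.

Lemma gpmonad_id_morphism (C E : category) (K : finite_coproducts C) (M : gpmonad E K) :
  @is_guarded_pmonad_morphism C E M M (gpm_guard M) (gpm_guard M)
    (fun X P => idm (M (X, P))).
Proof.
  split; [split | ].
  - now intros X Y P Q f p; rewrite comp_idl, comp_idr.
  - intros P; split.
    + now intros X; rewrite comp_idl.
    + now intros X Y f; rewrite !comp_idl, comp_idr.
  - now intros P X Y f s Hf; rewrite comp_idl.
Qed.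

Lemma gpmonad_comp_morphism (C E : category) (K : finite_coproducts C)
    (M N L : gpmonad E K) (b : gpmonad_hom N L) (a : gpmonad_hom M N) :
  @is_guarded_pmonad_morphism C E M L (gpm_guard M) (gpm_guard L)
    (fun X P => proj1_sig b X P ∘ proj1_sig a X P).
Proof.
  destruct a as [a [[an am] ag]], b as [b [[bn bm] bg]]; cbn.
  split; [split | ].
  - intros X Y P Q f p.
    now rewrite <- comp_assoc, an, !comp_assoc, bn.
  - intros P; destruct (am P) as [ar al], (bm P) as [br bl]; split.
    + now intros X; rewrite <- comp_assoc, ar, br.
    + intros X Y f.
      refine (eq_trans (eq_sym (comp_assoc _ _ _)) _).
      refine (eq_trans (f_equal (comp (b Y P)) (al _ _ f)) _).
      refine (eq_trans (comp_assoc _ _ _) _).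
      refine (eq_trans (f_equal (fun g => g ∘ a X P) (bl _ _ _)) _); cbn.
      now rewrite !comp_assoc.
  - intros P X Y f s Hf; rewrite <- comp_assoc.
    now apply bg, ag.
Qed.

Definition gpmonad_cat (C E : category) (K : finite_coproducts C) : category.
Proof.
  refine (@Category (gpmonad E K) (@gpmonad_hom C E K)
            (fun M => exist _ _ (gpmonad_id_morphism M))
            (fun M N L b a => exist _ _ (gpmonad_comp_morphism b a)) _ _ _);
    intros; apply eq_sig_hprop; try (intros; apply proof_irrelevance);
    do 2 (apply functional_extensionality_dep; intro); cbn.
  - apply comp_idl.
  - apply comp_idr.
  - apply comp_assoc.
Defined.
Arguments gpmonad_cat {C} E K.

Section Nu.
Context (C D : category).

Definition pm_section (M : pmonad_data C (prod_cat C D)) (X : C) (Z : D) :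
    functor_data C C :=
  @FunctorData C C (fun g => M (X, (g, Z)))
    (fun g h u => @pm_map _ (prod_cat C D) M X X (g, Z) (h, Z) (idm X) (u, idm Z)).

Definition final_coalgebras (M : pmonad_data C (prod_cat C D)) :=
  forall (X : C) (Z : D), final_coalgebra (pm_section M X Z).

Context (K : finite_coproducts C).
Context (M : pmonad_data C (prod_cat C D)) (fc : final_coalgebras M).

Definition nu_ob (X : C) (Z : D) : C := nu (fc X Z).

Definition nu_out (X : C) (Z : D) : nu_ob X Z ~> M (X, (nu_ob X Z, Z)) :=
  out (fc X Z).

Definition nu_coit (X : C) (Z : D) (A : C) (a : A ~> M (X, (A, Z))) : A ~> nu_ob X Z :=
  @coit _ _ (fc X Z) A a.

Definition map3 (X Y A B : C) (Z W : D) (f : X ~> Y) (u : A ~> B) (p : Z ~> W) :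
    M (X, (A, Z)) ~> M (Y, (B, W)) :=
  @pm_map _ (prod_cat C D) M X Y (A, Z) (B, W) f (u, p).

Definition nu_map (X Y : C) (Z W : D) (f : X ~> Y) (p : Z ~> W) :
    nu_ob X Z ~> nu_ob Y W :=
  nu_coit (map3 f (idm (nu_ob X Z)) p ∘ nu_out X Z).

(* The inverse of [nu_out] given by Lambek's lemma. *)
Definition nu_in (X : C) (Z : D) : M (X, (nu_ob X Z, Z)) ~> nu_ob X Z :=
  nu_coit (map3 (idm X) (nu_out X Z) (idm Z)).

Definition nu_ret (X : C) (Z : D) : X ~> nu_ob X Z :=
  nu_in X Z ∘ @pm_ret _ (prod_cat C D) M X (nu_ob X Z, Z).

Definition nu_bar (X Y : C) (Z : D) (f : X ~> nu_ob Y Z) :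
    X ~> M (Y, (nu_ob X Z ⊕ nu_ob Y Z, Z)) :=
  map3 (idm Y) cinr (idm Z) ∘ nu_out Y Z ∘ f.

Definition nu_hat (X Y : C) (Z : D) (f : X ~> nu_ob Y Z) :
    nu_ob X Z ~> M (Y, (nu_ob X Z ⊕ nu_ob Y Z, Z)) :=
  @pm_lift _ (prod_cat C D) M X Y (nu_ob X Z ⊕ nu_ob Y Z, Z) (nu_bar f)
    ∘ map3 (idm X) cinl (idm Z) ∘ nu_out X Z.

Definition nu_lift_coalg (X Y : C) (Z : D) (f : X ~> nu_ob Y Z) :
    nu_ob X Z ⊕ nu_ob Y Z ~> M (Y, (nu_ob X Z ⊕ nu_ob Y Z, Z)) :=
  [nu_hat f ; map3 (idm Y) cinr (idm Z) ∘ nu_out Y Z].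

Definition nu_lift (X Y : C) (Z : D) (f : X ~> nu_ob Y Z) : nu_ob X Z ~> nu_ob Y Z :=
  nu_coit (nu_lift_coalg f) ∘ cinl.

Definition nu_pmonad : pmonad_data C D :=
  @PMonadData C D
    (@FunctorData (prod_cat C D) C (fun XZ => nu_ob (fst XZ) (snd XZ))
       (fun XZ YW fp => nu_map (fst fp) (snd fp)))
    nu_ret nu_lift.

Definition nu_ret_spec (X : C) (Z : D) (u : X ~> nu_ob X Z) : Prop :=
  nu_out X Z ∘ u = @pm_ret _ (prod_cat C D) M X (nu_ob X Z, Z).

Definition nu_lift_spec (X Y : C) (Z : D) (f : X ~> nu_ob Y Z)
    (g : nu_ob X Z ~> nu_ob Y Z) : Prop :=
  nu_out Y Z ∘ [g ; idm (nu_ob Y Z)]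
    = map3 (idm Y) [g ; idm (nu_ob Y Z)] (idm Z) ∘ nu_lift_coalg f.

Definition nu_guard (G : pm_guardedness M) : pm_guardedness nu_pmonad :=
  fun Z X Y f s => G (nu_ob Y Z, Z) X Y (nu_out Y Z ∘ f) s.

Definition nu_iter (G : pm_guardedness M) (dag : pm_iteration K G) :
    pm_iteration K (nu_guard G) :=
  fun Z X Y f Hf =>
    let P : prod_cat C D := (nu_ob (Y ⊕ X) Z, Z) in
    nu_coit (pm_lift M [pm_ret M Y P ; dag P X Y (nu_out (Y ⊕ X) Z ∘ f) Hf]
               ∘ nu_out (Y ⊕ X) Z)
      ∘ nu_ret (Y ⊕ X) Z ∘ cinr.

End Nu.
Arguments nu_ret_spec {C D M} fc {X Z} u.
Arguments nu_guard {C D} K {M} fc G P X Y _ _.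
Arguments nu_iter {C D K M} fc {G} dag P X Y f _.

Definition nu_mor (C D : category) (K : finite_coproducts C)
    (M N : pmonad_data C (prod_cat C D))
    (fM : final_coalgebras M) (fN : final_coalgebras N)
    (a : pm_components M N) :
    pm_components (nu_pmonad K fM) (nu_pmonad K fN) :=
  fun X Z => nu_coit fN (a X (nu_ob fM X Z, Z) ∘ nu_out fM X Z).

(* The domain of the functor [# |-> #^nu]: guarded parametrized monads with
   (chosen) final coalgebras, and all guarded parametrized monad morphisms. *)
Record gpmonad_nu (C D : category) (K : finite_coproducts C) := GPMonadNu {
  gpn_gpm :> gpmonad (prod_cat C D) K;
  gpn_fc : final_coalgebras gpn_gpm
}.

Definition gpmonad_nu_cat (C D : category) (K : finite_coproducts C) : category :=
  let A := gpmonad_cat (prod_cat C D) K in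
  @Category (gpmonad_nu D K)
    (fun M N => @hom A (gpn_gpm M) (gpn_gpm N))
    (fun M => @idm A (gpn_gpm M))
    (fun M N L => @comp A (gpn_gpm M) (gpn_gpm N) (gpn_gpm L))
    (fun M N => @comp_idl A (gpn_gpm M) (gpn_gpm N))
    (fun M N => @comp_idr A (gpn_gpm M) (gpn_gpm N))
    (fun M N L P => @comp_assoc A (gpn_gpm M) (gpn_gpm N) (gpn_gpm L) (gpn_gpm P)).
Arguments gpmonad_nu_cat {C} D K.

(* The two hypotheses say that [#^nu] and [alpha^nu] are an object and a
   morphism of the codomain; they are what makes the assignment well-typed. *)
Definition nu_functor (C D : category) (K : finite_coproducts C)
    (Hob : forall M : gpmonad_nu D K,
       is_guarded_pmonad K (nu_guard K (gpn_fc M) (gpm_guard M)))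
    (Hmor : forall (M N : gpmonad_nu D K) (a : gpmonad_hom M N),
       is_guarded_pmonad_morphism
         (nu_guard K (gpn_fc M) (gpm_guard M))
         (nu_guard K (gpn_fc N) (gpm_guard N))
         (nu_mor K (gpn_fc M) (gpn_fc N) (proj1_sig a))) :
    functor_data (gpmonad_nu_cat D K) (gpmonad_cat D K) :=
  @FunctorData (gpmonad_nu_cat D K) (gpmonad_cat D K)
    (fun M => GPMonad (Hob M))
    (fun M N a => exist _ _ (Hmor M N a)).

(* Main.v *)
From Corelib Require Import ssreflect.
From Stdlib Require Import FunctionalExtensionality ProofIrrelevance.
Require Import Defs.

Set Implicit Arguments.
Unset Strict Implicit.
Unset Printing Implicit Defensive.

(** Lambek's lemma turns the definition of [f‡] into the single equation
    [out ∘ f‡ = (out ∘ f)^* ∘ (id # (f‡, id)) ∘ out].  More generally, for every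
    coalgebra [a : A -> X # (A, Z)] and every [k : X -> Y #^ν Z], the equation
    [out ∘ h = (out ∘ k)^* ∘ (id # (h, id)) ∘ a] has the unique solution
    [h = k‡ ∘ coit a], since [[h, id]] is then a coalgebra morphism on
    [A + Y #^ν Z].  All monad and monad morphism laws follow by checking that both
    sides solve the same equation.

    For iteration, put [e = (out ∘ f)^†] and [c = coit ([η, e]^* ∘ out)].  Then
    [out ∘ f†† = (id # (c, id)) ∘ e] and [c = [η^ν, f††]‡], which makes [f††] a
    solution.  Conversely, if [g] is a solution and [w = [η^ν, g]‡], then
    [out ∘ g] solves [(id # (w, id)) ∘ out ∘ f], hence equals
    [(id # (w, id)) ∘ e] by uniqueness and compatibility of [†]; therefore [w] is a
    coalgebra morphism, [w = c], and [g = f††]. *)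

(* [nu_lift] and [nu_ret] are compositions by definition, and ssreflect's [rewrite]
   would match [comp_assoc] through them; [rewrite ->] does not. *)
Ltac assocl := rewrite -> ?comp_assoc.
Ltac assocr := rewrite <- ?comp_assoc.

(** * Composition and copairing in a category *)

Section Composition.
Context (C : category).

(** This form and [comp_absorb] let an equation between composites rewrite the middle of a
    right-nested composite. *)
Lemma comp_whisker (X Y Y' Z W : C) (g : Y ~> Z) (f : X ~> Y)
    (g' : Y' ~> Z) (f' : X ~> Y') :
  g ∘ f = g' ∘ f' -> forall h : W ~> X, g ∘ (f ∘ h) = g' ∘ (f' ∘ h).
Proof. by move=> e h; rewrite !comp_assoc e. Qed.

Lemma comp_absorb (X Y Z W : C) (g : Y ~> Z) (f : X ~> Y) (k : X ~> Z) :
  g ∘ f = k -> forall h : W ~> X, g ∘ (f ∘ h) = k ∘ h.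
Proof. by move=> e h; rewrite comp_assoc e. Qed.

Lemma comp_copair (K : finite_coproducts C) (X Y Z W : C) (h : Z ~> W)
    (f : X ~> Z) (g : Y ~> Z) :
  h ∘ [f ; g] = [h ∘ f ; h ∘ g].
Proof. by apply: copair_unique; rewrite -comp_assoc (copair_inl, copair_inr). Qed.

Lemma coproduct_ext (K : finite_coproducts C) (X Y Z : C) (h k : X ⊕ Y ~> Z) :
  h ∘ cinl = k ∘ cinl -> h ∘ cinr = k ∘ cinr -> h = k.
Proof.
by move=> el er; rewrite (copair_unique el er); symmetry; apply: copair_unique.
Qed.

End Composition.

(** * The parametrized monad laws with the parameter split into a pair *)

Section TernaryOperations.
Context (C D : category) (M : pmonad_data C (prod_cat C D)).

(** The parameter is displayed as a pair, so that unification need not guess an object of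
    [prod_cat C D]. *)
Definition ret3 (X A : C) (Z : D) : X ~> M (X, (A, Z)) :=
  @pm_ret _ (prod_cat C D) M X (A, Z).

Definition lift3 (X Y A : C) (Z : D) (f : X ~> M (Y, (A, Z))) :
    M (X, (A, Z)) ~> M (Y, (A, Z)) :=
  @pm_lift _ (prod_cat C D) M X Y (A, Z) f.

Context (HM : is_pmonad M).

Lemma map3_id (X A : C) (Z : D) : map3 M (idm X) (idm A) (idm Z) = idm _.
Proof. exact: (fmap_id (pm_is_functor HM)). Qed.

Lemma map3_comp (X Y V A B E : C) (Z W U : D) (f' : Y ~> V) (u' : B ~> E)
    (p' : W ~> U) (f : X ~> Y) (u : A ~> B) (p : Z ~> W) :
  map3 M f' u' p' ∘ map3 M f u p = map3 M (f' ∘ f) (u' ∘ u) (p' ∘ p).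
Proof.
by symmetry; apply: (@fmap_comp _ _ _ (pm_is_functor HM)
  (X, (A, Z)) (Y, (B, W)) (V, (E, U)) (f', (u', p')) (f, (u, p))).
Qed.

(** Separates the change of parameter, a monad morphism, from the functorial action of one fixed
    monad. *)
Lemma map3_factor (X Y A B : C) (Z W : D) (f : X ~> Y) (u : A ~> B) (p : Z ~> W) :
  map3 M f u p = map3 M (idm Y) u p ∘ map3 M f (idm A) (idm Z).
Proof. by rewrite map3_comp comp_idl !comp_idr. Qed.

Lemma lift3_ret3 (X A : C) (Z : D) : lift3 (ret3 X A Z) = idm _.
Proof. exact: (@lift_ret _ _ (pm_is_monad HM (A, Z))). Qed.

Lemma lift3_comp_ret3 (X Y A : C) (Z : D) (f : X ~> M (Y, (A, Z))) :
  lift3 f ∘ ret3 X A Z = f.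
Proof. exact: (@lift_comp_ret _ _ (pm_is_monad HM (A, Z))). Qed.

Lemma lift3_comp (X Y V A : C) (Z : D) (g : Y ~> M (V, (A, Z)))
    (f : X ~> M (Y, (A, Z))) :
  lift3 (lift3 g ∘ f) = lift3 g ∘ lift3 f.
Proof. exact: (@lift_comp _ _ (pm_is_monad HM (A, Z))). Qed.

Lemma map3_mmap (X Y A : C) (Z : D) (f : X ~> Y) :
  map3 M f (idm A) (idm Z) = lift3 (ret3 Y A Z ∘ f).
Proof. exact: (@pm_map_mmap _ _ _ HM (A, Z)). Qed.

Lemma map3_ret3 (X A B : C) (Z W : D) (u : A ~> B) (p : Z ~> W) :
  map3 M (idm X) u p ∘ ret3 X A Z = ret3 X B W.
Proof.
exact: (monad_morphism_ret (@pm_is_monad_morphism _ _ _ HM (A, Z) (B, W) (u, p))).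
Qed.

Lemma map3_lift3 (X Y A B : C) (Z W : D) (u : A ~> B) (p : Z ~> W)
    (f : X ~> M (Y, (A, Z))) :
  map3 M (idm Y) u p ∘ lift3 f
    = lift3 (map3 M (idm Y) u p ∘ f) ∘ map3 M (idm X) u p.
Proof.
exact: (monad_morphism_lift (@pm_is_monad_morphism _ _ _ HM (A, Z) (B, W) (u, p)) f).
Qed.

End TernaryOperations.

(** * Corecursion into the final coalgebras and the monad laws *)

Section NuMonad.
Context (C D : category) (K : finite_coproducts C).
Context (M : pmonad_data C (prod_cat C D)) (fc : final_coalgebras M).
Context (HM : is_pmonad M).

Notation out := (nu_out fc).
Notation "X ^ν Z" := (nu_ob fc X Z) (at level 30).
Notation "⟦ u ⟧" := (map3 M (idm _) u (idm _)) (at level 0).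

Lemma out_coit (X A : C) (Z : D) (a : A ~> M (X, (A, Z))) :
  out X Z ∘ nu_coit fc a = ⟦nu_coit fc a⟧ ∘ a.
Proof. exact: (coit_mor (fc X Z) a). Qed.

Lemma nu_coit_unique (X A : C) (Z : D) (a : A ~> M (X, (A, Z))) (h : A ~> X ^ν Z) :
  out X Z ∘ h = ⟦h⟧ ∘ a -> h = nu_coit fc a.
Proof. exact: (@coit_unique _ _ (fc X Z)). Qed.

Lemma nu_coit_out (X : C) (Z : D) : nu_coit fc (out X Z) = idm _.
Proof. by symmetry; apply: nu_coit_unique; rewrite map3_id // comp_idl comp_idr. Qed.

(** Lambek: the composite is a coalgebra endomorphism of the final coalgebra. *)
Lemma nu_in_out (X : C) (Z : D) : nu_in fc X Z ∘ out X Z = idm _.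
Proof.
rewrite -nu_coit_out; apply: nu_coit_unique.
by rewrite comp_assoc out_coit map3_comp // !comp_idl.
Qed.

Lemma nu_out_in (X : C) (Z : D) : out X Z ∘ nu_in fc X Z = idm _.
Proof. by rewrite out_coit map3_comp // !comp_idl nu_in_out map3_id. Qed.

Lemma nu_out_mono (X A : C) (Z : D) (g h : A ~> X ^ν Z) :
  out X Z ∘ g = out X Z ∘ h -> g = h.
Proof.
by move=> e; rewrite -(comp_idl g) -(comp_idl h) -nu_in_out -!comp_assoc e.
Qed.

Lemma out_nu_ret (X : C) (Z : D) : out X Z ∘ nu_ret fc X Z = ret3 M X (X ^ν Z) Z.
Proof. by rewrite /nu_ret comp_assoc nu_out_in comp_idl. Qed.

Lemma out_nu_map (X Y : C) (Z W : D) (f : X ~> Y) (p : Z ~> W) :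
  out Y W ∘ nu_map fc f p = map3 M f (nu_map fc f p) p ∘ out X Z.
Proof. by rewrite out_coit comp_assoc map3_comp // !comp_idl comp_idr. Qed.

Lemma nu_map_unique (X Y : C) (Z W : D) (f : X ~> Y) (p : Z ~> W)
    (h : X ^ν Z ~> Y ^ν W) :
  out Y W ∘ h = map3 M f h p ∘ out X Z -> h = nu_map fc f p.
Proof.
move=> e; apply: nu_coit_unique.
by rewrite e comp_assoc map3_comp // !comp_idl comp_idr.
Qed.

(** For [a := out X Z] this is convertible to [nu_lift_coalg]. *)
Definition corec_coalg (X Y A : C) (Z : D) (k : X ~> Y ^ν Z)
    (a : A ~> M (X, (A, Z))) : A ⊕ Y ^ν Z ~> M (Y, (A ⊕ Y ^ν Z, Z)) :=
  [lift3 (⟦cinr⟧ ∘ out Y Z ∘ k) ∘ ⟦cinl⟧ ∘ a ; ⟦cinr⟧ ∘ out Y Z].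

(** The right component holds for every [h]. On the left, [⟦[h ; idm _]⟧] is a monad morphism and
    passes under the lifting, where it cancels [cinr]; outside, it turns [cinl] into [h]. *)
Lemma corec_coalg_mor (X Y A : C) (Z : D) (k : X ~> Y ^ν Z)
    (a : A ~> M (X, (A, Z))) (h : A ~> Y ^ν Z) :
  out Y Z ∘ [h ; idm _] = ⟦[h ; idm _]⟧ ∘ corec_coalg k a
  <-> out Y Z ∘ h = lift3 (out Y Z ∘ k) ∘ ⟦h⟧ ∘ a.
Proof.
have el : ⟦[h ; idm _]⟧ ∘ corec_coalg k a ∘ cinl
    = lift3 (out Y Z ∘ k) ∘ ⟦h⟧ ∘ a.
  rewrite -(comp_assoc ⟦_⟧) copair_inl !comp_assoc map3_lift3 //.
  rewrite -(comp_assoc (lift3 _)) map3_comp // !comp_assoc map3_comp //.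
  by rewrite copair_inl copair_inr !comp_idl map3_id // comp_idl.
have er : ⟦[h ; idm _]⟧ ∘ corec_coalg k a ∘ cinr = out Y Z.
  by rewrite -(comp_assoc ⟦_⟧) copair_inr !comp_assoc map3_comp // copair_inr
    !comp_idl map3_id // comp_idl.
split=> [e|e].
  by rewrite -el -e -comp_assoc copair_inl.
apply: coproduct_ext; first by rewrite el -comp_assoc copair_inl.
by rewrite er -comp_assoc copair_inr comp_idr.
Qed.

Lemma nu_lift_specP (X Y : C) (Z : D) (f : X ~> Y ^ν Z) (g : X ^ν Z ~> Y ^ν Z) :
  nu_lift_spec K f g <-> out Y Z ∘ g = lift3 (out Y Z ∘ f) ∘ ⟦g⟧ ∘ out X Z.
Proof. exact: (corec_coalg_mor f (out X Z) g). Qed.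

(** Restricted along [cinr], the coiteration is a coalgebra endomorphism of the final coalgebra,
    hence the identity. *)
Lemma nu_lift_copair (X Y : C) (Z : D) (f : X ~> Y ^ν Z) :
  [nu_lift K f ; idm _] = nu_coit fc (nu_lift_coalg K f).
Proof.
symmetry; apply: copair_unique => //.
rewrite -nu_coit_out; apply: nu_coit_unique.
rewrite comp_assoc out_coit -comp_assoc copair_inr comp_assoc map3_comp //.
by rewrite !comp_idl.
Qed.

Lemma nu_lift_satisfies_spec (X Y : C) (Z : D) (f : X ~> Y ^ν Z) :
  nu_lift_spec K f (nu_lift K f).
Proof. by rewrite /nu_lift_spec nu_lift_copair out_coit. Qed.

Lemma out_nu_lift (X Y : C) (Z : D) (f : X ~> Y ^ν Z) :
  out Y Z ∘ nu_lift K f = lift3 (out Y Z ∘ f) ∘ ⟦nu_lift K f⟧ ∘ out X Z.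
Proof. exact/nu_lift_specP/nu_lift_satisfies_spec. Qed.

(** Both sides solve the equation, so by [corec_coalg_mor] their copairings with the identity are
    coiterations of the same coalgebra. *)
Lemma corec_unique (X Y A : C) (Z : D) (k : X ~> Y ^ν Z)
    (a : A ~> M (X, (A, Z))) (h : A ~> Y ^ν Z) :
  out Y Z ∘ h = lift3 (out Y Z ∘ k) ∘ ⟦h⟧ ∘ a -> h = nu_lift K k ∘ nu_coit fc a.
Proof.
move=> /corec_coalg_mor /nu_coit_unique eh.
have: out Y Z ∘ (nu_lift K k ∘ nu_coit fc a)
    = lift3 (out Y Z ∘ k) ∘ ⟦nu_lift K k ∘ nu_coit fc a⟧ ∘ a.
  rewrite comp_assoc out_nu_lift -comp_assoc out_coit.
  by rewrite !comp_assoc -(comp_assoc _ ⟦_⟧ ⟦_⟧) map3_comp // !comp_idl.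
move=> /corec_coalg_mor /nu_coit_unique; rewrite -eh => e.
by rewrite -(copair_inl h (idm _)) -e copair_inl.
Qed.

Lemma nu_lift_unique (X Y : C) (Z : D) (f : X ~> Y ^ν Z) (g : X ^ν Z ~> Y ^ν Z) :
  out Y Z ∘ g = lift3 (out Y Z ∘ f) ∘ ⟦g⟧ ∘ out X Z -> g = nu_lift K f.
Proof. by move=> /corec_unique; rewrite nu_coit_out comp_idr. Qed.

Lemma nu_map_id (X : C) (Z : D) : nu_map fc (idm X) (idm Z) = idm _.
Proof. by symmetry; apply: nu_map_unique; rewrite map3_id // comp_idl comp_idr. Qed.

Lemma nu_map_comp (X Y V : C) (Z W U : D) (g : Y ~> V) (q : W ~> U)
    (f : X ~> Y) (p : Z ~> W) :
  nu_map fc (g ∘ f) (q ∘ p) = nu_map fc g q ∘ nu_map fc f p.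
Proof.
symmetry; apply: nu_map_unique.
by rewrite comp_assoc out_nu_map -comp_assoc out_nu_map comp_assoc map3_comp.
Qed.

Lemma nu_lift_ret (X : C) (Z : D) : nu_lift K (nu_ret fc X Z) = idm _.
Proof.
symmetry; apply: nu_lift_unique.
by rewrite out_nu_ret lift3_ret3 // map3_id // !comp_idl comp_idr.
Qed.

Lemma nu_lift_comp_ret (X Y : C) (Z : D) (f : X ~> Y ^ν Z) :
  nu_lift K f ∘ nu_ret fc X Z = f.
Proof.
apply: nu_out_mono.
by rewrite comp_assoc out_nu_lift -!comp_assoc out_nu_ret map3_ret3 // lift3_comp_ret3.
Qed.

Lemma nu_lift_comp (X Y V : C) (Z : D) (g : Y ~> V ^ν Z) (f : X ~> Y ^ν Z) :
  nu_lift K (nu_lift K g ∘ f) = nu_lift K g ∘ nu_lift K f.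
Proof.
symmetry; apply: nu_lift_unique.
assocl; rewrite out_nu_lift; assocr; rewrite out_nu_lift lift3_comp //; assocr.
(* Both sides now start with the lifting of [out V Z ∘ g]; moving [⟦nu_lift K g⟧] past the next
   lifting aligns the rest. *)
rewrite (comp_whisker (map3_lift3 HM _ _ _)).
by rewrite (comp_absorb (map3_comp HM _ _ _ _ _ _)) !comp_idl.
Qed.

Lemma nu_map_mmap (X Y : C) (Z : D) (f : X ~> Y) :
  nu_map fc f (idm Z) = nu_lift K (nu_ret fc Y Z ∘ f).
Proof.
apply: nu_lift_unique.
by rewrite comp_assoc out_nu_ret -map3_mmap // map3_comp // !(comp_idl, comp_idr) out_nu_map.
Qed.

Lemma nu_map_ret (X : C) (Z W : D) (p : Z ~> W) :
  nu_map fc (idm X) p ∘ nu_ret fc X Z = nu_ret fc X W.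
Proof.
apply: nu_out_mono.
by rewrite comp_assoc out_nu_map -comp_assoc !out_nu_ret map3_ret3.
Qed.

Lemma nu_map_lift (X Y : C) (Z W : D) (p : Z ~> W) (f : X ~> Y ^ν Z) :
  nu_map fc (idm Y) p ∘ nu_lift K f
    = nu_lift K (nu_map fc (idm Y) p ∘ f) ∘ nu_map fc (idm X) p.
Proof.
(* [nu_map] unfolds to a coiteration, which supplies the coalgebra [a]. *)
apply: corec_unique.
rewrite !comp_assoc out_nu_map -!comp_assoc out_nu_lift.
rewrite -comp_assoc (comp_whisker (map3_lift3 HM _ _ _)).
by rewrite !(comp_absorb (map3_comp HM _ _ _ _ _ _)) !(comp_idl, comp_idr).
Qed.

Lemma nu_is_pmonad : is_pmonad (nu_pmonad K fc).
Proof.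
split.
- split=> [[X Z]|[X Z] [Y W] [V U] [g q] [f p]]; first exact: nu_map_id.
  exact: nu_map_comp.
- move=> Z; split=> *; [exact: nu_lift_ret|exact: nu_lift_comp_ret|exact: nu_lift_comp].
- by move=> Z X Y f; apply: nu_map_mmap.
- by move=> Z W p; split=> *; [apply: nu_map_ret|apply: nu_map_lift].
Qed.

Lemma nu_ret_spec_unique (X : C) (Z : D) : unique (nu_ret_spec fc) (nu_ret fc X Z).
Proof.
split=> [|u hu]; first exact: out_nu_ret.
by apply: nu_out_mono; rewrite out_nu_ret.
Qed.

Lemma nu_lift_spec_unique (X Y : C) (Z : D) (f : X ~> Y ^ν Z) :
  unique (nu_lift_spec K f) (nu_lift K f).
Proof.
split=> [|g /nu_lift_specP hg]; first exact: nu_lift_satisfies_spec.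
by symmetry; apply: nu_lift_unique.
Qed.

End NuMonad.

(** * Guardedness of the derived monad *)

Section NuGuarded.
Context (C D : category) (K : finite_coproducts C).
Context (M : pmonad_data C (prod_cat C D)) (fc : final_coalgebras M).
Context (G : pm_guardedness M) (HG : is_guarded_pmonad K G).

Let HM : is_pmonad M := gpm_is_pmonad HG.

Lemma map3_guarded (X Y A B : C) (Z W : D) (u : A ~> B) (p : Z ~> W)
    (f : X ~> M (Y, (A, Z))) (s : summand Y) :
  G (P := (A, Z)) f s -> G (P := (B, W)) (map3 M (idm Y) u p ∘ f) s.
Proof. exact: (@gpm_preserves _ _ _ _ _ HG (A, Z) (B, W) (u, p)). Qed.

(** Composing with [out] turns each rule into the same rule for [#], up to a change of parameter,
    which [map3_guarded] handles. *)
Lemma nu_guard_is_guarded (Z : D) : is_guarded K (nu_guard K fc G Z).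
Proof.
split.
- move=> X Y V f; rewrite /nu_guard.
  change (mmap _ _) with (nu_lift K (nu_ret fc (Y ⊕ V) Z ∘ cinl)).
  rewrite -nu_map_mmap // comp_assoc out_nu_map //.
  rewrite map3_factor // map3_mmap //; assocr; apply: map3_guarded.
  exact: (guarded_trv (gpm_is_guarded HG (_, Z))).
- move=> X Y V s f g hf hg; rewrite /nu_guard comp_copair.
  exact: (guarded_par (gpm_is_guarded HG (_, Z))).
- move=> X Y V U s f g h hf hg; rewrite /nu_guard.
  change (lift _ _) with (nu_lift K [g ; h]).
  assocl; rewrite out_nu_lift //; assocr; rewrite comp_copair.
  apply: (guarded_cmp (gpm_is_guarded HG (_, Z))) => //.
  exact: map3_guarded.
Qed.

Lemma nu_is_guarded_pmonad : is_guarded_pmonad K (nu_guard K fc G).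
Proof.
split; [exact: nu_is_pmonad|exact: nu_guard_is_guarded|].
move=> Z W p X Y f s hf; rewrite /nu_guard.
change (pm_map _ _ _) with (nu_map fc (idm Y) p).
by rewrite comp_assoc out_nu_map // -comp_assoc; apply: map3_guarded.
Qed.

End NuGuarded.

(** * The action on parametrized monad morphisms *)

Section NuMorphism.
Context (C D : category) (K : finite_coproducts C).
Context (M N : pmonad_data C (prod_cat C D)).
Context (fM : final_coalgebras M) (fN : final_coalgebras N).
Context (HM : is_pmonad M) (HN : is_pmonad N).
Context (a : pm_components M N) (Ha : is_pmonad_morphism a).

Notation a3 X A Z := (a X (A, Z)).
Notation anu := (nu_mor K fM fN a).

Lemma pmm_map3 (X Y A B : C) (Z W : D) (f : X ~> Y) (u : A ~> B) (p : Z ~> W) :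
  a3 Y B W ∘ map3 M f u p = map3 N f u p ∘ a3 X A Z.
Proof. exact: (@pmm_natural _ _ _ _ _ Ha X Y (A, Z) (B, W) f (u, p)). Qed.

Lemma pmm_ret3 (X A : C) (Z : D) : a3 X A Z ∘ ret3 M X A Z = ret3 N X A Z.
Proof. exact: (monad_morphism_ret (pmm_monad_morphism Ha (A, Z))). Qed.

Lemma pmm_lift3 (X Y A : C) (Z : D) (f : X ~> M (Y, (A, Z))) :
  a3 Y A Z ∘ lift3 f = lift3 (a3 Y A Z ∘ f) ∘ a3 X A Z.
Proof. exact: (monad_morphism_lift (pmm_monad_morphism Ha (A, Z)) f). Qed.

Lemma out_nu_mor (X : C) (Z : D) :
  nu_out fN X Z ∘ anu X Z
    = map3 N (idm X) (anu X Z) (idm Z) ∘ (a3 X _ Z ∘ nu_out fM X Z).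
Proof. exact: out_coit. Qed.

Lemma nu_mor_natural (X Y : C) (Z W : D) (f : X ~> Y) (p : Z ~> W) :
  anu Y W ∘ nu_map fM f p = nu_map fN f p ∘ anu X Z.
Proof.
(* Both sides are coalgebra morphisms out of this common coalgebra, which applies first [a] and then
   the action of [f] and [p]. *)
transitivity (nu_coit fN (map3 N f (idm _) p ∘ (a3 X _ Z ∘ nu_out fM X Z))).
  apply: nu_coit_unique; rewrite comp_assoc out_nu_mor; assocr.
  rewrite out_nu_map // (comp_whisker (pmm_map3 _ _ _)).
  by rewrite !(comp_absorb (map3_comp HN _ _ _ _ _ _)) !(comp_idl, comp_idr).
symmetry; apply: nu_coit_unique; rewrite comp_assoc out_nu_map //; assocr.
rewrite out_nu_mor.
by rewrite !(comp_absorb (map3_comp HN _ _ _ _ _ _)) !(comp_idl, comp_idr).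
Qed.

Lemma nu_mor_ret (X : C) (Z : D) : anu X Z ∘ nu_ret fM X Z = nu_ret fN X Z.
Proof.
apply: nu_out_mono => //.
rewrite comp_assoc out_nu_mor; assocr.
by rewrite !out_nu_ret // pmm_ret3 map3_ret3.
Qed.

Lemma nu_mor_lift (X Y : C) (Z : D) (f : X ~> nu_ob fM Y Z) :
  anu Y Z ∘ nu_lift K f = nu_lift K (anu Y Z ∘ f) ∘ anu X Z.
Proof.
(* Here the coalgebra is [a] after [out], whose coiteration is [nu_mor]. *)
apply: corec_unique => //.
assocl; rewrite out_nu_mor; assocr; rewrite out_nu_lift //; assocr.
rewrite (comp_whisker (pmm_lift3 _)) (comp_whisker (map3_lift3 HN _ _ _)).
rewrite (comp_whisker (pmm_map3 _ _ _)).
by rewrite !(comp_absorb (map3_comp HN _ _ _ _ _ _)) !(comp_idl, comp_idr).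
Qed.

Lemma nu_mor_is_pmonad_morphism : is_pmonad_morphism anu.
Proof.
split=> [*|Z]; first exact: nu_mor_natural.
by split=> *; [apply: nu_mor_ret|apply: nu_mor_lift].
Qed.

End NuMorphism.

(** * Functoriality on guarded parametrized monads *)

Section NuFunctor.
Context (C D : category) (K : finite_coproducts C).

Lemma nu_mor_is_guarded_pmonad_morphism (M N : gpmonad_nu D K) (a : gpmonad_hom M N) :
  is_guarded_pmonad_morphism
    (nu_guard K (gpn_fc M) (gpm_guard M)) (nu_guard K (gpn_fc N) (gpm_guard N))
    (nu_mor K (gpn_fc M) (gpn_fc N) (proj1_sig a)).
Proof.
case: a => a [Ha Hg] /=.
have HM := gpm_is_pmonad (gpm_laws M); have HN := gpm_is_pmonad (gpm_laws N).
split; first exact: nu_mor_is_pmonad_morphism.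
move=> Z X Y f s hf; rewrite /nu_guard comp_assoc out_nu_mor; assocr.
apply: (map3_guarded (gpm_laws N)).
exact: (Hg (_, Z)).
Qed.

Lemma nu_mor_id (M : pmonad_data C (prod_cat C D)) (fM : final_coalgebras M) :
  is_pmonad M ->
  forall (X : C) (Z : D), nu_mor K fM fM (fun Y P => idm (M (Y, P))) X Z = idm _.
Proof.
move=> HM X Z; rewrite -(nu_coit_out fM HM) /nu_mor; congr nu_coit.
exact: comp_idl.
Qed.

Lemma nu_mor_comp (M N L : pmonad_data C (prod_cat C D)) (fM : final_coalgebras M)
    (fN : final_coalgebras N) (fL : final_coalgebras L)
    (a : pm_components M N) (b : pm_components N L) :
  is_pmonad L -> is_pmonad_morphism b ->
  forall (X : C) (Z : D),
    nu_mor K fM fL (fun Y P => b Y P ∘ a Y P) X Z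
      = nu_mor K fN fL b X Z ∘ nu_mor K fM fN a X Z.
Proof.
move=> HL Hb X Z; symmetry; apply: nu_coit_unique.
rewrite comp_assoc out_nu_mor; assocr; rewrite out_nu_mor.
rewrite (comp_whisker (pmm_map3 Hb _ _ _)).
by rewrite (comp_absorb (map3_comp HL _ _ _ _ _ _)) !comp_idl.
Qed.

Lemma nu_functor_is_functor :
  is_functor (nu_functor
    (fun M : gpmonad_nu D K => nu_is_guarded_pmonad (gpn_fc M) (gpm_laws M))
    nu_mor_is_guarded_pmonad_morphism).
Proof.
(* Morphisms carry proofs, so equality reduces to equality of their components. *)
split=> [M|M N L b a]; apply: eq_sig_hprop => /= [*|]; try exact: proof_irrelevance.
- do 2 (apply: functional_extensionality_dep => ?).
  exact/nu_mor_id/(gpm_is_pmonad (gpm_laws M)).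
- do 2 (apply: functional_extensionality_dep => ?).
  apply: nu_mor_comp; first exact: (gpm_is_pmonad (gpm_laws L)).
  exact: (gpmm_is_pmonad_morphism (proj2_sig b)).
Qed.

End NuFunctor.

(** * Iteration and uniqueness of solutions *)

Section NuIteration.
Context (C D : category) (K : finite_coproducts C).
Context (M : pmonad_data C (prod_cat C D)) (fc : final_coalgebras M).
Context (G : pm_guardedness M) (dag : pm_iteration K G).
Context (Hdag : is_guarded_preiterative dag).

Notation out := (nu_out fc).
Notation "X ^ν Z" := (nu_ob fc X Z) (at level 30).
Notation "⟦ u ⟧" := (map3 M (idm _) u (idm _)) (at level 0).

Let HG : is_guarded_pmonad K G := gpi_is_guarded Hdag.
Let HM : is_pmonad M := gpm_is_pmonad HG.

Definition dag3 (A : C) (Z : D) (X Y : C) (f : X ~> M (Y ⊕ X, (A, Z)))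
    (Hf : G (P := (A, Z)) f inr_summand) : X ~> M (Y, (A, Z)) :=
  dag (P := (A, Z)) Hf.

Lemma dag3_solution (A : C) (Z : D) (X Y : C) (f : X ~> M (Y ⊕ X, (A, Z)))
    (Hf : G (P := (A, Z)) f inr_summand) :
  dag3 Hf = lift3 [ret3 M Y A Z ; dag3 Hf] ∘ f.
Proof. exact: (gpi_solution Hdag Hf). Qed.

(** The type of [Hg] depends on [g], so [g] is left free up to an equation instead of being a fixed
    composite. *)
Lemma map3_dag3 (A B : C) (Z W : D) (u : A ~> B) (p : Z ~> W) (X Y : C)
    (f : X ~> M (Y ⊕ X, (A, Z))) (g : X ~> M (Y ⊕ X, (B, W)))
    (Hf : G (P := (A, Z)) f inr_summand) (Hg : G (P := (B, W)) g inr_summand) :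
  map3 M (idm (Y ⊕ X)) u p ∘ f = g -> map3 M (idm Y) u p ∘ dag3 Hf = dag3 Hg.
Proof.
move=> e; case: _ / e Hg => Hg.
exact: (@gpi_compat _ _ _ _ _ _ Hdag (A, Z) (B, W) (u, p)).
Qed.

Section Equation.
Context (X Y : C) (Z : D) (f : X ~> (Y ⊕ X) ^ν Z).
Context (Hf : G (P := ((Y ⊕ X) ^ν Z, Z)) (out (Y ⊕ X) Z ∘ f) inr_summand).

Definition unfold_coalg : (Y ⊕ X) ^ν Z ~> M (Y, ((Y ⊕ X) ^ν Z, Z)) :=
  lift3 [ret3 M Y _ Z ; dag3 Hf] ∘ out (Y ⊕ X) Z.

Lemma nu_iterE :
  nu_iter fc dag Z X Y f Hf = nu_coit fc unfold_coalg ∘ nu_ret fc (Y ⊕ X) Z ∘ cinr.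
Proof. by []. Qed.

Lemma out_nu_iter :
  out Y Z ∘ nu_iter fc dag Z X Y f Hf = ⟦nu_coit fc unfold_coalg⟧ ∘ dag3 Hf.
Proof.
rewrite nu_iterE; assocl; rewrite out_coit /unfold_coalg; assocr.
rewrite (comp_absorb (out_nu_ret fc HM _ _)) (comp_absorb (lift3_comp_ret3 HM _)).
by rewrite copair_inr.
Qed.

Lemma unfold_lift :
  nu_coit fc unfold_coalg = nu_lift K [nu_ret fc Y Z ; nu_iter fc dag Z X Y f Hf].
Proof.
apply: nu_lift_unique => //.
rewrite comp_copair out_nu_iter out_nu_ret // out_coit {2}/unfold_coalg comp_assoc.
by rewrite map3_lift3 // comp_copair map3_ret3.
Qed.

Lemma nu_iter_solution :
  nu_iter fc dag Z X Y f Hf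
    = nu_lift K [nu_ret fc Y Z ; nu_iter fc dag Z X Y f Hf] ∘ f.
Proof.
apply: nu_out_mono => //.
rewrite -unfold_lift out_nu_iter; assocl; rewrite out_coit /unfold_coalg; assocr.
by rewrite -dag3_solution.
Qed.

(** Uniqueness of solutions for [#] is a premise, so that only pre-iterativity is assumed throughout
    the section. *)
Lemma nu_iter_unique (g : X ~> Y ^ν Z) :
  (forall (A : C) (f' : X ~> M (Y ⊕ X, (A, Z)))
      (Hf' : G (P := (A, Z)) f' inr_summand) (g' : X ~> M (Y, (A, Z))),
    g' = lift3 [ret3 M Y A Z ; g'] ∘ f' -> g' = dag3 Hf') ->
  g = nu_lift K [nu_ret fc Y Z ; g] ∘ f -> g = nu_iter fc dag Z X Y f Hf.
Proof.
move=> uniq; set w := nu_lift K _ => eg.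
have ew : out Y Z ∘ w = lift3 [ret3 M Y _ Z ; out Y Z ∘ g] ∘ ⟦w⟧ ∘ out (Y ⊕ X) Z.
  by rewrite out_nu_lift // comp_copair out_nu_ret.
have eog : out Y Z ∘ g = ⟦w⟧ ∘ dag3 Hf.
  have Hw : G (P := (Y ^ν Z, Z)) (⟦w⟧ ∘ (out (Y ⊕ X) Z ∘ f)) inr_summand.
    exact: map3_guarded.
  (* Compatibility moves the problem to the parameter [(Y ^ν Z, Z)], where [out Y Z ∘ g] is a
     solution. *)
  rewrite (map3_dag3 _ Hw) //; apply: uniq.
  by rewrite {1}eg comp_assoc ew; assocr.
(* This matches the shape of [nu_iterE], leaving only [w] to be identified with the coiteration. *)
have -> : g = w ∘ nu_ret fc _ Z ∘ cinr by rewrite nu_lift_comp_ret // copair_inr.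
rewrite nu_iterE; congr (_ ∘ _ ∘ _); apply: nu_coit_unique.
by rewrite ew eog /unfold_coalg comp_assoc map3_lift3 // comp_copair map3_ret3.
Qed.

End Equation.

Lemma nu_map_iter (Z W : D) (p : Z ~> W) (X Y : C) (f : X ~> (Y ⊕ X) ^ν Z)
    (Hf : nu_guard K fc G Z X (Y ⊕ X) f inr_summand)
    (Hpf : nu_guard K fc G W X (Y ⊕ X) (nu_map fc (idm _) p ∘ f) inr_summand) :
  nu_map fc (idm Y) p ∘ nu_iter fc dag Z X Y f Hf = nu_iter fc dag W X Y _ Hpf.
Proof.
(* Compatibility of [dag] is used with both coordinates of the parameter changing at once. *)
have e : map3 M (idm Y) (nu_map fc (idm _) p) p ∘ dag3 Hf = dag3 Hpf.
  by apply: map3_dag3; assocl; rewrite out_nu_map.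
have ec : nu_map fc (idm Y) p ∘ nu_coit fc (unfold_coalg Hf)
    = nu_coit fc (unfold_coalg Hpf) ∘ nu_map fc (idm _) p.
  transitivity (nu_coit fc (map3 M (idm Y) (idm _) p ∘ unfold_coalg Hf)).
    apply: nu_coit_unique; rewrite comp_assoc out_nu_map // -comp_assoc out_coit.
    by rewrite !(comp_absorb (map3_comp HM _ _ _ _ _ _)) !(comp_idl, comp_idr).
  symmetry; apply: nu_coit_unique.
  rewrite comp_assoc out_coit -comp_assoc {2}/unfold_coalg -comp_assoc out_nu_map //.
  (* Unit and solution are both written as images under one change of parameter, which can then be
     pulled out of the lifting. *)
  rewrite -e -(map3_ret3 HM Y (nu_map fc (idm (Y ⊕ X)) p) p) -comp_copair.
  rewrite (comp_whisker (eq_sym (map3_lift3 HM _ _ _))).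
  by rewrite !(comp_absorb (map3_comp HM _ _ _ _ _ _)) !(comp_idl, comp_idr).
rewrite !nu_iterE; assocl; rewrite ec; assocr.
by rewrite (comp_absorb (nu_map_ret fc HM _ _)).
Qed.

Lemma nu_is_guarded_preiterative : is_guarded_preiterative (nu_iter fc dag).
Proof.
split; [exact: nu_is_guarded_pmonad| |] => *; first exact: nu_iter_solution.
exact: nu_map_iter.
Qed.

End NuIteration.

Lemma nu_is_guarded_iterative (C D : category) (K : finite_coproducts C)
    (M : pmonad_data C (prod_cat C D)) (fc : final_coalgebras M)
    (G : pm_guardedness M) (dag : pm_iteration K G) :
  is_guarded_iterative dag -> is_guarded_iterative (nu_iter fc dag).
Proof.
case=> Hdag uniq; split; first exact: nu_is_guarded_preiterative.
move=> Z X Y f Hf g; apply: (nu_iter_unique Hdag) => A f' Hf' g'.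
exact: (uniq (A, Z)).
Qed.

Theorem theorem4p3 (C D : category) (K : finite_coproducts C) :
  (* [#^nu] is a parametrized monad, with the unit and lifting described *)
  (forall (M : pmonad_data C (prod_cat C D)) (fc : final_coalgebras M),
     is_pmonad M ->
     is_pmonad (nu_pmonad K fc)
     /\ (forall (X : C) (Z : D), unique (nu_ret_spec fc) (nu_ret fc X Z))
     /\ (forall (X Y : C) (Z : D) (f : X ~> nu_ob fc Y Z),
           unique (nu_lift_spec K f) (nu_lift K f)))
  (* (1) *)
  /\ (forall (M : pmonad_data C (prod_cat C D)) (fc : final_coalgebras M)
         (G : pm_guardedness M),
        is_guarded_pmonad K G -> is_guarded_pmonad K (nu_guard K fc G))
  /\ (exists Hob Hmor, is_functor (@nu_functor C D K Hob Hmor))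
  (* (2) *)
  /\ (forall (M : pmonad_data C (prod_cat C D)) (fc : final_coalgebras M)
         (G : pm_guardedness M) (dag : pm_iteration K G),
        is_guarded_preiterative dag -> is_guarded_preiterative (nu_iter fc dag))
  (* (3) *)
  /\ (forall (M : pmonad_data C (prod_cat C D)) (fc : final_coalgebras M)
         (G : pm_guardedness M) (dag : pm_iteration K G),
        is_guarded_iterative dag -> is_guarded_iterative (nu_iter fc dag)).
Proof.
split; [|split; [|split; [|split]]].
- move=> M fc HM; split; [exact: nu_is_pmonad|split=> *].
    exact: nu_ret_spec_unique.
  exact: nu_lift_spec_unique.
- by move=> M fc G; apply: nu_is_guarded_pmonad.
- by do 2 eexists; apply: nu_functor_is_functor.
- by move=> M fc G dag; apply: nu_is_guarded_preiterative.
- by move=> M fc G dag; apply: nu_is_guarded_iterative.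
Qed.
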